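(* For every total privacy budget $\epsilon_b>0$, every split $\epsilon_b=\epsilon_r+\epsilon_p$ with $\epsilon_r,\epsilon_p>0$, and all hyperparameters $\alpha>1$, $\beta>0$, $0<\gamma\le 1$, the randomized algorithm HDPView (defined in the context), which maps a database to a p-view (the set of converged blocks together with their noisy sums), satisfies $\epsilon_b$-differential privacy. More precisely, its recursive bisection part (random converge together with random cut), whose output is the partition $\pi$, satisfies $\epsilon_r$-differential privacy, and together with the perturbation part, which consumes $\epsilon_p$, the whole algorithm satisfies $(\epsilon_r+\epsilon_p)=\epsilon_b$-differential privacy.
   Context: Data. A database is a finite multiset of records over $d$ attributes $a_1,\dots,a_d$, each with a finite ordered domain $dom(a_i)$. It is represented by its count tensor $\mathcal{X}$, which assigns to each cell of $\prod_i dom(a_i)$ the number of records (a nonnegative integer) with those attribute values. A block $\mathcal{B}$ is the restriction of $\mathcal{X}$ to a product of nonempty intervals (ranges) $\prod_i r[s_{a_i},e_{a_i}]$. $|\mathcal{B}|$ is its number of cells, and $x\in\mathcal{B}$ ranges over the counts of its cells. Differential privacy. Two databases are neighboring if they differ in at most one record (one record added or removed, so that a single cell count changes by one and a histogram has L1-sensitivity $1$). A randomized mechanism $\mathcal{M}$ satisfies $\epsilon$-differential privacy if $\Pr[\mathcal{M}(D)\in Z]\le e^{\epsilon}\Pr[\mathcal{M}(D')\in Z]$ for all neighboring $D,D'$ and all (measurable) sets $Z$ of outputs. $Lap(\lambda)$ denotes a Laplace random variable with mean $0$ and scale $\lambda$; all draws are independent. Aggregation error. $\mathrm{AE}(\mathcal{B})=\sum_{x\in\mathcal{B}}\left|x-\frac{S}{|\mathcal{B}|}\right|$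 with $S=\sum_{x\in\mathcal{B}}x$. Algorithm HDPView. Set $\kappa=\beta\log_2\tilde n$, where $\tilde n=\prod_i|dom(a_i)|$ is the total domain size; $\theta=1/\epsilon_p$; $\epsilon_{cut}=(1-\gamma)\epsilon_r/\kappa$; $\lambda=\left(\frac{2\alpha-1}{\alpha-1}+1\right)\cdot\frac{2}{\gamma\epsilon_r}=\frac{3\alpha-2}{\alpha-1}\cdot\frac{2}{\gamma\epsilon_r}$; $\delta=\lambda\log\alpha$ (natural logarithm). Start with $\pi=\emptyset$ and apply the following recursive procedure to the initial block $\mathcal{B}^{(0)}=\mathcal{X}$ at depth $k=1$. For a block $\mathcal{B}$ at depth $k$: 1. (Random converge) Let $\mathrm{BAE}(\mathcal{B})=\max(\theta+2-\delta,\ \mathrm{AE}(\mathcal{B})-k\delta)$. If $\mathrm{BAE}(\mathcal{B})+Lap(\lambda)\le\theta$, add $\mathcal{B}$ to $\pi$ and stop processing this block. A block with a single cell cannot be split and is always added to $\pi$. 2. (Random cut) Otherwise, choose a cutting point $p$, i.e. an attribute and a value at which that attribute's range is cut, splitting $\mathcal{B}$ into two nonempty blocks $\mathcal{B}_L^{(p)},\mathcal{B}_R^{(p)}$. If $k\le\kappa$, choose $p$ by the exponential mechanism with probability proportional to $\exp\left(\frac{\epsilon_{cut}Q(\mathcal{B},p)}{2\Delta_Q}\right)$, where $Q(\mathcal{B},p)=-(\mathrm{AE}(\mathcal{B}_L^{(p)})+\mathrm{AE}(\mathcal{B}_R^{(p)}))$, $\Delta_Q=2\Delta_{AE}$, and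 $\Delta_{AE}=2(1-1/|\mathcal{B}|)$ is the L1-sensitivity of $\mathrm{AE}$. If $k>\kappa$, choose $p$ by data-independent random sampling among the admissible cutting points. 3. Apply the procedure to each of $\mathcal{B}_L^{(p)}$ and $\mathcal{B}_R^{(p)}$ at depth $k+1$. When all blocks have converged, $\pi=\{\mathcal{B}_1,\dots,\mathcal{B}_m\}$ is a partition of $\mathcal{X}$ into blocks. (Perturbation) For each $i$, output the ranges of $\mathcal{B}_i$ and the noisy sum $\tilde S_i=S_i+z_i$, where $S_i=\sum_{x\in\mathcal{B}_i}x$ and $z_i\sim Lap(1/\epsilon_p)$ are independent. *)

(* Defs.v *)
From HB Require Import structures.
From mathcomp Require Import all_boot all_order all_algebra.
From mathcomp Require Import all_classical all_reals all_analysis.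
From mathcomp Require Import measurable_realfun giry.

Set Implicit Arguments.
Unset Strict Implicit.
Unset Printing Implicit Defensive.

Import Order.TTheory GRing.Theory Num.Theory.
Import numFieldNormedType.Exports.

Local Open Scope classical_set_scope.
Local Open Scope ring_scope.

Definition laplace_pdf {R : realType} (b x : R) : R :=
  (2 * b)^-1 * expR (- (`|x| / b)).

(* [Lap(b)] has density [laplace_pdf b] for [0 < b]; as for the distributions
   of the library, a degenerate value is used outside the meaningful range, so
   that [laplace_prob b] is a probability for every [b]. *)
Definition laplace_prob {R : realType} (b : R) : set R -> \bar R :=
  fun V => if 0 < b then (\int[lebesgue_measure]_(x in V) (laplace_pdf b x)%:E)%E
           else \d_(0 : R) V.

Section laplace.
Context {R : realType} (b : R).
Notation mu := (@lebesgue_measure R).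

Lemma laplace_pdf_ge0 x : 0 < b -> 0 <= laplace_pdf b x.
Proof. by move=> b0; rewrite mulr_ge0 ?expR_ge0// invr_ge0 mulr_ge0// ltW. Qed.

Lemma continuous_laplace_pdf : continuous (laplace_pdf b).
Proof.
move=> x; apply: (@continuousM _ R^o (fun=> (2 * b)^-1)
  (fun x => expR (- (`|x| / b)))).
  exact: cst_continuous.
apply: (@continuous_comp R R^o R (fun x => - (`|x| / b))); last exact: continuous_expR.
apply: (@continuousN _ R^o _ (fun x => `|x| / b)).
apply: (@continuousM _ R^o (fun x => `|x|) (fun=> b^-1)); last exact: cst_continuous.
exact: norm_continuous.
Qed.

Lemma measurable_laplace_pdf : measurable_fun [set: R] (laplace_pdf b).
Proof. by apply: continuous_measurable_fun; exact: continuous_laplace_pdf. Qed.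

Lemma integral_laplace_pdf : 0 < b -> (\int[mu]_x (laplace_pdf b x)%:E = 1)%E.
Proof.
move=> b0; rewrite ge0_symfun_integralT; last first.
- by move=> x; rewrite /laplace_pdf /= normrN.
- exact: continuous_laplace_pdf.
- by move=> x; exact: laplace_pdf_ge0.
have bV0 : 0 < b^-1 by rewrite invr_gt0.
have -> : (\int[mu]_(x in [set x | (0 <= x)%R]) (laplace_pdf b x)%:E =
  \int[mu]_(x in [set x | (0 <= x)%R]) ((2^-1)%:E * (exponential_pdf b^-1 x)%:E))%E.
  apply: eq_integral => x; rewrite inE/= => x0.
  rewrite exponential_pdfE// /laplace_pdf ger0_norm// -EFinM; congr EFin.
  by rewrite invfM mulrA mulNr (mulrC x).
rewrite ge0_integralZl//=; last 3 first.
- by rewrite -set_itvcy.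
- apply: measurable_funTS; apply/measurable_EFinP.
  by apply: measurable_exponential_pdf; exact: ltW.
- by move=> x _; rewrite lee_fin exponential_pdf_ge0// ltW.
rewrite muleA -EFinM divff// mul1e -set_itvcy.
rewrite integral_mkcond -[RHS](integral_exponential_pdf bV0).
apply: eq_integral => x _; rewrite patchE; case: ifPn => //.
rewrite set_itvE notin_setE/= => /negP; rewrite -ltNge => x0.
by rewrite lt0_exponential_pdf.
Qed.

Let laplace0 : laplace_prob b set0 = 0%E.
Proof. by rewrite /laplace_prob; case: ifP; rewrite ?integral_set0 ?measure0. Qed.

Let laplace_ge0 A : (0 <= laplace_prob b A)%E.
Proof.
rewrite /laplace_prob; case: ifP => // b0; apply: integral_ge0 => x _.
by rewrite lee_fin laplace_pdf_ge0.
Qed.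

Let laplace_sigma_additive : semi_sigma_additive (laplace_prob b).
Proof.
have -> : laplace_prob b = if 0 < b then
    (fun V => \int[mu]_(x in V) (laplace_pdf b x)%:E)%E else \d_(0 : R).
  by apply/funext => V; rewrite /laplace_prob; case: ifP.
case: ifPn => b0; last exact: measure_semi_sigma_additive.
move=> /= F mF tF mUF; apply: cvg_toP.
  apply: ereal_nondecreasing_is_cvgn => m n mn.
  apply: lee_sum_nneg_natr => // k _ _; apply: integral_ge0 => /= x Fkx.
  by rewrite lee_fin laplace_pdf_ge0.
rewrite ge0_integral_bigcup//=.
- by apply/measurable_funTS/measurableT_comp => //; exact: measurable_laplace_pdf.
- by move=> x _; rewrite lee_fin laplace_pdf_ge0.
Qed.

HB.instance Definition _ := isMeasure.Build _ _ _
  (laplace_prob b) laplace0 laplace_ge0 laplace_sigma_additive.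

Let laplace_setT : laplace_prob b [set: R] = 1%E.
Proof.
rewrite /laplace_prob; case: ifPn => b0; first exact: integral_laplace_pdf.
by rewrite diracT.
Qed.

HB.instance Definition _ :=
  @Measure_isProbability.Build _ _ R (laplace_prob b) laplace_setT.

End laplace.

Fixpoint laplace_tuple {R : realType} (b : R) (n : nat) :
    giry (n.-tuple R) R :=
  if n is m.+1 return giry (n.-tuple R) R then
    giry_map (measurable_cons measurable_fst measurable_snd)
      (giry_prod (laplace_prob b : giry R R, laplace_tuple b m))
  else giry_ret [tuple].

Lemma laplace_tuple_setT (R : realType) (b : R) n :
  laplace_tuple b n [set: n.-tuple R] = 1%E.
Proof.
elim: n => [|n IH] /=; first exact: diracT.
rewrite /giry_map /pushforward preimage_setT /giry_prod /=.
rewrite -setXTT product_measure1E//= IH mule1.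
exact: probability_setT.
Qed.

Definition discr (T : Type) : Type := T.

HB.instance Definition _ (T : pointedType) := Pointed.copy (discr T) T.
HB.instance Definition _ (T : pointedType) :=
  @isMeasurable.Build default_measure_display (discr T) (@discrete_measurable T)
    discrete_measurable0 discrete_measurableC discrete_measurableU.

Lemma discr_measurable_fun (T : pointedType) d (U : measurableType d)
  (f : discr T -> U) : measurable_fun [set: discr T] f.
Proof. by []. Qed.

Definition dbind (R : realType) (T : pointedType) d (U : measurableType d)
    (m : giry (discr T) R) (f : T -> giry U R) : giry U R :=
  giry_bind m (discr_measurable_fun f).

Lemma dbind_setT (R : realType) (T : pointedType) d (U : measurableType d)
    (m : giry (discr T) R) (f : T -> giry U R) :
  m [set: discr T] = 1%E -> (forall x, f x [set: U] = 1%E) ->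
  dbind m f [set: U] = 1%E.
Proof.
move=> m1 f1; rewrite /dbind /giry_bind /=.
transitivity (giry_int (giry_map (discr_measurable_fun f) m)
  (giry_ev ^~ [set: U])) => //.
rewrite giry_int_map//; last exact: measurable_giry_ev.
rewrite /giry_int (eq_integral (cst 1%E)); last by move=> x _ /=; exact: f1.
by rewrite integral_cst// mul1e.
Qed.

(* Choose [p] in [A] with probability proportional to [w p], then run [f p]. *)
Definition draw (R : realType) (T : finType) d (U : measurableType d)
    (A : {set T}) (w : T -> {nonneg R}) (f : T -> giry U R) : set U -> \bar R :=
  fun Z => (\sum_(p in A)
    ((w p)%:num / \sum_(p' in A) (w p')%:num)%:E * f p Z)%E.

Section draw.
Context (R : realType) (T : finType) d (U : measurableType d).
Variables (A : {set T}) (w : T -> {nonneg R}) (f : T -> giry U R).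

Let w_ge0 p : 0 <= (w p)%:num / \sum_(p' in A) (w p')%:num.
Proof. by rewrite divr_ge0// sumr_ge0. Qed.

Let draw0 : draw A w f set0 = 0%E.
Proof. by rewrite /draw big1// => p _; rewrite measure0 mule0. Qed.

Let draw_ge0 Z : (0 <= draw A w f Z)%E.
Proof. by apply: sume_ge0 => p _; rewrite mule_ge0// lee_fin w_ge0. Qed.

Let draw_sigma_additive : semi_sigma_additive (draw A w f).
Proof.
move=> F mF tF mUF; rewrite [X in X @ \oo --> _](_ : _ = fun n =>
    (\sum_(p in A) ((w p)%:num / \sum_(p' in A) (w p')%:num)%:E *
      \sum_(0 <= i < n) f p (F i))%E); last first.
  apply/funext => n; rewrite /draw exchange_big/=; apply: eq_bigr => p _.
  by rewrite ge0_sume_distrr.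
apply: cvg_nnesum => p _.
  by apply: nearW => n; rewrite mule_ge0 ?lee_fin ?w_ge0// sume_ge0.
by apply: cvgeZl => //; exact: measure_semi_sigma_additive.
Qed.

HB.instance Definition _ := isMeasure.Build _ _ _ (draw A w f)
  draw0 draw_ge0 draw_sigma_additive.

Lemma draw_setT1 : \sum_(p in A) (w p)%:num != 0 ->
  (forall p, p \in A -> f p [set: U] = 1%E) -> draw A w f [set: U] = 1%E.
Proof.
move=> s0 f1; rewrite /draw (eq_bigr (fun p =>
  ((w p)%:num / \sum_(p' in A) (w p')%:num)%:E)); last first.
  by move=> p pA; rewrite f1// mule1.
by rewrite sumEFin -mulr_suml divff.
Qed.

Let draw_setT : (draw A w f [set: U] <= 1)%E.
Proof.
rewrite /draw (@le_trans _ _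
  (\sum_(p in A) ((w p)%:num / \sum_(p' in A) (w p')%:num)%:E)%E)//.
  apply: lee_sum => p _; rewrite -[leRHS]mule1 lee_wpmul2l ?lee_fin ?w_ge0//.
  exact: sprobability_setT.
rewrite sumEFin lee_fin -mulr_suml.
have [->|s0] := eqVneq (\sum_(p in A) (w p)%:num) 0; first by rewrite mul0r.
by rewrite divff.
Qed.

HB.instance Definition _ :=
  Measure_isSubProbability.Build _ _ _ (draw A w f) draw_setT.

End draw.

Section database.
Context (d : nat) (disp : Order.disp_t) (dom : 'I_d -> finTBOrderType disp).

Definition cell := {dffun forall i : 'I_d, dom i}.

(* A multiset of records, given by its count tensor. *)
Definition database := {ffun cell -> nat}.

Definition add_record (c : cell) (X : database) : database :=
  [ffun c' => (X c' + (c' == c))%N].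

Definition neighbor (X Y : database) : Prop :=
  X = Y \/ exists c, Y = add_record c X \/ X = add_record c Y.

Definition diff_private (R : realType) (eps : R) dO (O : measurableType dO)
    (M : database -> giry O R) : Prop :=
  forall X Y, neighbor X Y -> forall Z : set O, measurable Z ->
    (M X Z <= (expR eps)%:E * M Y Z)%E.

(* A product of ranges, given by the cell of their starts and the cell of
   their ends. *)
Definition block := (cell * cell)%type.

Definition cells (B : block) : {set cell} :=
  finset (fun c : cell => [forall i, B.1 i <= c i <= B.2 i]%O).

Definition full_block : block := ([ffun i => \bot%O], [ffun i => \top%O]).

(* [Tagged _ v], with tag [i], cuts a range [s, e] of [a_i] into [s, v] and
   [v + 1, e]. *)
Definition cutpoint := {i : 'I_d & dom i}.

Definition cuts (B : block) : {set cutpoint} :=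
  finset (fun p : cutpoint => B.1 (tag p) <= tagged p < B.2 (tag p))%O.

(* The successor of [v], when [v] is not the last value. *)
Definition next_value (i : 'I_d) (v : dom i) : dom i :=
  [arg min_(w < \top | v < w) w]%O.

Definition set_value (c : cell) (i : 'I_d) (v : dom i) : cell :=
  [ffun j => @dfwith _ (fun i => dom i) c i v j].

Definition cutl (B : block) (p : cutpoint) : block :=
  (B.1, set_value B.2 (tagged p)).

Definition cutr (B : block) (p : cutpoint) : block :=
  (set_value B.1 (next_value (tagged p)), B.2).

Definition valid_block (B : block) : Prop := forall i, (B.1 i <= B.2 i)%O.

Lemma cuts_neq0 B : valid_block B -> #|cells B| != 1%N ->
  cuts B != finset.set0.
Proof.
move=> vB; apply: contraNneq => cB0.
suff -> : cells B = [set B.1]%SET by rewrite cards1.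
have E i : B.1 i = B.2 i.
  apply/eqP; rewrite eq_le vB/= leNgt; apply/negP => lt12.
  have : (Tagged _ (B.1 i) : cutpoint) \in cuts B by rewrite inE/= lexx.
  by rewrite cB0 inE.
apply/setP => c; rewrite !inE; apply/forallP/eqP => [h|-> i].
  by apply/ffunP => i; have /andP[l u] := h i; apply/eqP; rewrite eq_le l E u.
by rewrite lexx vB.
Qed.

Lemma valid_cutl B p : valid_block B -> p \in cuts B -> valid_block (cutl B p).
Proof.
move=> vB; rewrite inE => /andP[h _] i; rewrite /cutl /= ffunE.
by case: dfwithP => //=.
Qed.

Lemma valid_cutr B p : valid_block B -> p \in cuts B -> valid_block (cutr B p).
Proof.
move=> vB; rewrite inE => /andP[_ h] i; rewrite /cutr /= ffunE.
case: dfwithP => //=; rewrite /next_value.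
by case: Order.TotalTheory.arg_minP => [|j _ ->//]; exact: lt_le_trans h (lex1 _).
Qed.

Definition block_set := {set block}.

HB.instance Definition _ := Finite.on block_set.
HB.instance Definition _ := isPointed.Build block_set finset.set0.

Definition is_partition (P : block_set) : Prop :=
  forall c : cell, exists! B : block, B \in P /\ c \in cells B.

Definition block_sum (X : database) (B : block) : nat :=
  (\sum_(c in cells B) X c)%N.

Definition AE (R : realType) (X : database) (B : block) : R :=
  \sum_(c in cells B) `|(X c)%:R - (block_sum X B)%:R / #|cells B|%:R|.

(* The noisy sum at position [i] of the tuple is that of the block
   [enum_val i] of the partition. *)
Definition pview (R : realType) : Type :=
  {P : block_set & #|(P : {set block})|.-tuple R}.

Section pview.
Context (R : realType).

HB.instance Definition _ := gen_eqMixin (pview R).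
HB.instance Definition _ := gen_choiceMixin (pview R).
HB.instance Definition _ := isPointed.Build (pview R)
  (existT (fun P : block_set => #|(P : {set block})|.-tuple R) point point).

(* A set of p-views is measurable when, for each of the finitely many
   partitions, the noisy sums which it allows form a Borel set. *)
Definition pview_measurable (Z : set (pview R)) : Prop :=
  forall P : block_set, measurable [set t : #|(P : {set block})|.-tuple R |
    Z (existT _ P t)].

Let pview_measurable0 : pview_measurable set0.
Proof. by move=> P; exact: measurable0. Qed.

Let pview_measurableC Z : pview_measurable Z -> pview_measurable (~` Z).
Proof. by move=> mZ P; exact: measurableC (mZ P). Qed.

Let pview_measurable_bigcup (F : (set (pview R))^nat) :
  (forall i, pview_measurable (F i)) -> pview_measurable (\bigcup_i F i).
Proof. by move=> mF P; exact: bigcupT_measurable (fun i => mF i P). Qed.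

HB.instance Definition _ := @isMeasurable.Build default_measure_display
  (pview R) pview_measurable
  pview_measurable0 pview_measurableC pview_measurable_bigcup.

Definition add_noise (X : database) (P : block_set)
    (z : #|(P : {set block})|.-tuple R) : pview R :=
  existT _ P [tuple (block_sum X (enum_val i))%:R + tnth z i
    | i < #|(P : {set block})|].

Lemma measurable_add_noise X P : measurable_fun setT (@add_noise X P).
Proof.
move=> _ Z mZ; rewrite setTI.
have mf : measurable_fun setT (fun z : #|(P : {set block})|.-tuple R =>
    [tuple (block_sum X (enum_val i))%:R + tnth z i | i < #|(P : {set block})|]).
  apply/measurable_fun_tnthP => i.
  rewrite [X in measurable_fun _ X](_ : _ =
    fun z => (block_sum X (enum_val i))%:R + tnth z i); last first.
    by apply/funext => z /=; rewrite tnth_mktuple.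
  by apply: measurable_funD; [exact: measurable_cst|exact: measurable_tnth].
by have := mf measurableT _ (mZ P); rewrite setTI.
Qed.

End pview.

Section hdpview.
Context (R : realType) (eps_r eps_p alpha beta gamma : R).
(* The law of the data-independent cuts, which may depend on the depth and on
   the ranges of the block, but not on the database. *)
Context (q : nat -> block -> cutpoint -> {nonneg R}).

(* [kappa] is real: [k <= kappa] is compared in [R]. *)
Definition kappa : R :=
  beta * (ln (\prod_(i < d) #|dom i|)%N%:R / ln 2).
Definition theta : R := eps_p^-1.
Definition eps_cut : R := (1 - gamma) * eps_r / kappa.
Definition lambda : R :=
  ((2 * alpha - 1) / (alpha - 1) + 1) * (2 / (gamma * eps_r)).
Definition delta : R := lambda * ln alpha.

Section bisection.
Variable X : database.

Definition BAE (k : nat) (B : block) : R :=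
  Num.max (theta + 2 - delta) (AE R X B - k%:R * delta).

Lemma measurable_random_converge (k : nat) (B : block) :
  measurable_fun [set: R] (fun z : R => (BAE k B + z <= theta) : discr bool).
Proof.
have m1 : measurable_fun [set: R] (fun z : R => BAE k B + z <= theta).
  by apply: measurable_fun_ler => //; exact: measurable_funD.
by move=> _ A _; exact: m1.
Qed.

(* [true]: the block converges. *)
Definition random_converge (k : nat) (B : block) : giry (discr bool) R :=
  giry_map (measurable_random_converge k B) (laplace_prob lambda : giry R R).

Definition quality (B : block) (p : cutpoint) : R :=
  - (AE R X (cutl B p) + AE R X (cutr B p)).

Definition sensAE (B : block) : R := 2 * (1 - #|cells B|%:R^-1).
Definition sensQ (B : block) : R := 2 * sensAE B.

Definition exp_weight (B : block) (p : cutpoint) : {nonneg R} :=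
  NngNum (expR_ge0 (eps_cut * quality B p / (2 * sensQ B))).

Definition random_cut d' (O : measurableType d') (k : nat) (B : block)
    (f : cutpoint -> giry O R) : giry O R :=
  if k%:R <= kappa then (draw (cuts B) (exp_weight B) f : giry O R)
  else (draw (cuts B) (q k B) f : giry O R).

Definition ret_blocks (P : {set block}) : giry (discr block_set) R :=
  giry_ret (P : discr block_set).

(* [n] bounds the recursion: each cut removes at least one cell from a block,
   hence a block with at most [n] cells never exhausts it. *)
Fixpoint bisect (n k : nat) (B : block) : giry (discr block_set) R :=
  let stop := ret_blocks [set B] in
  if n isn't m.+1 then stop
  else if #|cells B| == 1%N then stop
  else dbind (random_converge k B) (fun converged : bool =>
    if converged then stop
    else random_cut k B (fun p =>
      dbind (bisect m k.+1 (cutl B p)) (fun pil : block_set =>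
      dbind (bisect m k.+1 (cutr B p)) (fun pir : block_set =>
      ret_blocks (pil :|: pir))))).

Definition recursive_bisection : giry (discr block_set) R :=
  bisect #|cell| 1 full_block.

Definition perturbation (P : block_set) : giry (pview R) R :=
  giry_map (@measurable_add_noise R X P)
    (laplace_tuple eps_p^-1 #|(P : {set block})|).

Definition hdpview : giry (pview R) R :=
  dbind recursive_bisection perturbation.

(* [giry] is a type of subprobabilities; no mass is lost by the algorithm. *)
Lemma recursive_bisection_setT :
  (forall k B, cuts B != finset.set0 -> \sum_(p in cuts B) (q k B p)%:num = 1) ->
  recursive_bisection [set: discr block_set] = 1%E.
Proof.
move=> q1; rewrite /recursive_bisection.
have : valid_block full_block by move=> i; rewrite !ffunE le0x.
elim: #|cell| 1%N full_block => [|n IH] k B vB /=; first exact: diracT.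
case: ifPn => cB; first exact: diracT.
apply: dbind_setT; first exact: (probability_setT (laplace_prob lambda)).
case; first exact: diracT.
have sub1 p : p \in cuts B ->
  dbind (bisect n k.+1 (cutl B p)) (fun pil : block_set =>
    dbind (bisect n k.+1 (cutr B p)) (fun pir : block_set =>
    ret_blocks (pil :|: pir))) [set: discr block_set] = 1%E.
  move=> pB; apply: dbind_setT; first exact/IH/valid_cutl.
  move=> l; apply: dbind_setT; first exact/IH/valid_cutr.
  by move=> r; exact: diracT.
have cuts0 := cuts_neq0 vB cB.
rewrite /random_cut; case: ifP => _; apply: draw_setT1 => //.
- have [p pB] := set0Pn _ cuts0.
  rewrite gt_eqF// (bigD1 p)//= ltr_wpDr ?expR_gt0//.
  by apply: sumr_ge0 => p' _; exact: expR_ge0.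
- by rewrite q1// oner_neq0.
Qed.

Lemma hdpview_setT :
  (forall k B, cuts B != finset.set0 -> \sum_(p in cuts B) (q k B p)%:num = 1) ->
  hdpview [set: pview R] = 1%E.
Proof.
move=> q1; apply: dbind_setT; first exact: recursive_bisection_setT.
by move=> P; exact: laplace_tuple_setT.
Qed.

End bisection.

End hdpview.

End database.

(* Main.v *)
Require Import Defs.
From mathcomp Require Import all_boot all_order all_algebra.
From mathcomp Require Import all_classical all_reals all_analysis.
From mathcomp Require Import measurable_realfun giry lra ring.

(* Two neighboring databases differ in one cell [c]; blocks which do not
   contain [c] are processed identically, so the privacy loss is incurred along
   a single path of blocks, from the root to the converged block containing [c].
   Each of the first [kappa] cuts costs [eps_cut], for a total of
   [(1 - gamma) * eps_r].
   For convergence, [AE] is monotone under inclusion of blocks (it is twice the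
   sum of the positive parts of the deviations from the mean) and [AE] changes
   by at most 2 between the databases.  Hence the larger of the two values of
   [AE - k * delta] drops by at least [delta] at each step.  Not converging costs
   nothing below [theta + 2 - delta], [2 / lambda] between there and
   [theta + 2], and [2 / lambda * exp (- u / lambda)] at [theta + 2 + u] with
   [u > 0].  As [exp (- delta / lambda) = 1 / alpha], the last costs form a
   geometric series; with the final convergence, which costs [2 / lambda], the
   total is at most [gamma * eps_r].
   For the whole algorithm, the noisy sums are [eps_p]-private for a fixed
   family of disjoint blocks, and the bisection produces no other family. *)

Set Implicit Arguments.
Unset Strict Implicit.
Unset Printing Implicit Defensive.

Import Order.TTheory GRing.Theory Num.Theory.
Import numFieldNormedType.Exports.

Local Open Scope classical_set_scope.
Local Open Scope ring_scope.

(** * Multiplicative domination of measures *)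

(** A relation between two laws instead of a property of mechanisms: in the recursion the loss
    depends on the block and on the cell where the databases differ. *)
Definition exp_dominated (R : realType) d (T : measurableType d) (e : R)
    (m1 m2 : set T -> \bar R) : Prop :=
  forall Z, measurable Z -> (m1 Z <= (expR e)%:E * m2 Z)%E.

Section exp_dominated.
Context (R : realType).

Lemma le_exp_dominated d (T : measurableType d) (e e' : R)
    (m1 m2 : {measure set T -> \bar R}) :
  e <= e' -> exp_dominated e m1 m2 -> exp_dominated e' m1 m2.
Proof.
move=> ee' m12 Z mZ; apply: le_trans (m12 Z mZ) _.
by rewrite lee_wpmul2r// lee_fin ler_expR.
Qed.

Lemma exp_dominated_refl d (T : measurableType d) (e : R)
    (m : {measure set T -> \bar R}) : 0 <= e -> exp_dominated e m m.
Proof.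
move=> e0; apply: (le_exp_dominated e0) => Z mZ.
by rewrite expR0 mul1e.
Qed.

Lemma exp_dominated_integral d (T : measurableType d) (e : R)
    (m1 m2 : {measure set T -> \bar R}) (f : T -> \bar R) :
  exp_dominated e m1 m2 -> measurable_fun setT f -> (forall x, 0 <= f x)%E ->
  (\int[m1]_x f x <= (expR e)%:E * \int[m2]_x f x)%E.
Proof.
move=> m12 mf f0.
rewrite -[leRHS](@ge0_integral_mscale _ _ _ _ _ _ (NngNum (expR_ge0 e)))//.
by apply: ge0_le_measure_integral => // S mS; exact: m12.
Qed.

Lemma dbindE (T : pointedType) d (U : measurableType d)
    (m : giry (discr T) R) (f : T -> giry U R) (Z : set U) : measurable Z ->
  dbind m f Z = (\int[m]_x f x Z)%E.
Proof.
move=> mZ; rewrite /dbind /giry_bind /=.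
transitivity (giry_int (giry_map (discr_measurable_fun f) m) (giry_ev ^~ Z)) => //.
by rewrite giry_int_map//; exact: measurable_giry_ev.
Qed.

Lemma dbind_eq0 (T : pointedType) d (U : measurableType d)
    (m : giry (discr T) R) (f : T -> giry U R) (Z : set U) (N : set T) :
  measurable Z -> m N = 0%E -> (forall x, ~ N x -> f x Z = 0%E) ->
  dbind m f Z = 0%E.
Proof.
move=> mZ mN f0; rewrite dbindE//.
rewrite (@ge0_ae_eq_integral _ _ _ _ _ _ (cst 0%E))//.
- by rewrite integral0.
- exists N; split => //= x /= h; apply: contrapT => Nx.
  by apply: h => _; exact: f0.
Qed.

(** Sequential composition: [m] is first replaced by [m'] under the integral, so the exceptional set
    has to be null for [m'] only. This admits continuations that are private on almost every
    intermediate output. *)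
Lemma dbind_exp_dominated_ae (T : pointedType) d (U : measurableType d)
    (m m' : giry (discr T) R) (f f' : T -> giry U R) (e1 e2 : R) (N : set T) :
  exp_dominated e1 m m' -> m' N = 0%E ->
  (forall x, ~ N x -> exp_dominated e2 (f x) (f' x)) ->
  exp_dominated (e1 + e2) (dbind m f) (dbind m' f').
Proof.
move=> mm' mN ff' Z mZ; rewrite !dbindE//.
apply: le_trans (exp_dominated_integral mm' _ _) _ => //.
rewrite expRD EFinM -muleA lee_pmul2l ?lte_fin ?expR_gt0//.
rewrite -ge0_integralZl ?lee_fin ?expR_ge0//.
apply: ae_ge0_le_integral => //.
- by move=> x _; rewrite mule_ge0// lee_fin expR_ge0.
- exists N; split => //= x /= h; apply: contrapT => Nx.
  by apply: h => _; exact: ff'.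
Qed.

Lemma dbind_exp_dominated (T : pointedType) d (U : measurableType d)
    (m m' : giry (discr T) R) (f f' : T -> giry U R) (e1 e2 : R) :
  exp_dominated e1 m m' -> (forall x, exp_dominated e2 (f x) (f' x)) ->
  exp_dominated (e1 + e2) (dbind m f) (dbind m' f').
Proof.
by move=> mm' ff'; apply: (dbind_exp_dominated_ae mm' (measure0 m')) => x _.
Qed.

Lemma dbind_boolE d (U : measurableType d)
    (m : giry (discr bool) R) (f : bool -> giry U R) (Z : set U) :
  measurable Z -> dbind m f Z =
    (m [set true] * f true Z + m [set false] * f false Z)%E.
Proof.
move=> mZ; rewrite dbindE//.
have -> : [set: discr bool] = [set true] `|` [set false].
  by apply/seteqP; split => [[]|]//= _; [left|right].
rewrite ge0_integral_setU//=; last first.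
  by apply/disj_setPS => -[] [].
have cstE (b : bool) : (\int[m]_(x in [set b]) f x Z = m [set b] * f b Z)%E.
  rewrite (eq_integral (cst (f b Z))); last by move=> x /[!inE] ->.
  by rewrite integral_cst// muleC.
by rewrite !cstE.
Qed.

(** Each outcome pays for itself, so the total is the larger of the two losses and not their sum:
    along a path, only the last block pays for converging. *)
Lemma dbind_bool_exp_dominated d (U : measurableType d)
    (m m' : giry (discr bool) R) (f f' : bool -> giry U R) (e et ef ut uf : R) :
  (m [set true] <= (expR et)%:E * m' [set true])%E ->
  (m [set false] <= (expR ef)%:E * m' [set false])%E ->
  exp_dominated ut (f true) (f' true) -> exp_dominated uf (f false) (f' false) ->
  et + ut <= e -> ef + uf <= e ->
  exp_dominated e (dbind m f) (dbind m' f').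
Proof.
move=> mt mf ft ff et_le ef_le Z mZ; rewrite !dbind_boolE//.
rewrite ge0_muleDr ?mule_ge0//; apply: leeD.
- apply: (@le_trans _ _ ((expR et)%:E * m' [set true] * ((expR ut)%:E * f' true Z)))%E.
    by apply: lee_pmul => //; exact: ft.
  by rewrite muleACA -EFinM -expRD lee_wpmul2r ?mule_ge0// lee_fin ler_expR.
- apply: (@le_trans _ _ ((expR ef)%:E * m' [set false] * ((expR uf)%:E * f' false Z)))%E.
    by apply: lee_pmul => //; exact: ff.
  by rewrite muleACA -EFinM -expRD lee_wpmul2r ?mule_ge0// lee_fin ler_expR.
Qed.

Lemma draw_exp_dominated (T : finType) d (U : measurableType d) (A : {set T})
    (w w' : T -> {nonneg R}) (f f' : T -> giry U R) (e1 e2 : R) :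
  (forall p, p \in A -> (w p)%:num / (\sum_(p' in A) (w p')%:num)
     <= expR e1 * ((w' p)%:num / (\sum_(p' in A) (w' p')%:num))) ->
  (forall p, p \in A -> exp_dominated e2 (f p) (f' p)) ->
  exp_dominated (e1 + e2) (draw A w f) (draw A w' f').
Proof.
move=> ww' ff' Z mZ; rewrite /draw ge0_sume_distrr; last first.
  by move=> p pA; rewrite mule_ge0// lee_fin divr_ge0// sumr_ge0.
apply: lee_sum => p pA; rewrite expRD (EFinM (expR e1)) muleACA -EFinM.
apply: lee_pmul => //.
- by rewrite lee_fin divr_ge0// sumr_ge0.
- by rewrite lee_fin ww'.
- exact: ff'.
Qed.

(** One half of [e] pays for the change of the weight, the other for that of the normalizing sum. *)
Lemma exponential_mechanism (T : finType) (A : {set T}) (w w' : T -> R) (e : R) :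
  (forall p, 0 < w p) -> (forall p, 0 < w' p) ->
  (forall p, p \in A -> w p <= expR (e / 2) * w' p) ->
  (forall p, p \in A -> w' p <= expR (e / 2) * w p) ->
  forall p, p \in A ->
    w p / (\sum_(p' in A) w p') <= expR e * (w' p / (\sum_(p' in A) w' p')).
Proof.
move=> w0 w'0 ww' w'w p pA.
have s0 (v : T -> R) : (forall p, 0 < v p) -> 0 < \sum_(p' in A) v p'.
  by move=> v0; rewrite (bigD1 p)//= ltr_wpDr// sumr_ge0// => *; exact: ltW.
have s'le : \sum_(p' in A) w' p' <= expR (e / 2) * \sum_(p' in A) w p'.
  by rewrite mulr_sumr; apply: ler_sum.
have -> : e = e / 2 + e / 2 by field.
rewrite expRD mulrACA; apply: ler_pM.
- exact: ltW.
- by rewrite invr_ge0 ltW// s0.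
- exact: ww'.
- by rewrite ler_pdivlMr ?s0// mulrC ler_pdivrMr ?s0.
Qed.

End exp_dominated.

(** * Shifts of the Laplace distribution *)

Section laplace_shift.
Context (R : realType).
Notation mu := (@lebesgue_measure R).

Lemma lebesgue_measure_shift (s : R) (A : set R) : measurable A ->
  pushforward mu (+%R s : _ -> measurableTypeR R) A = mu A.
Proof.
have ms : measurable_fun setT (+%R s : R -> measurableTypeR R).
  exact: measurable_funD.
move=> mA; apply/esym.
apply: (@lebesgue_measure_unique _
  (pushforward mu (+%R s : _ -> measurableTypeR R))) => //= _ [[a b]] _ <-.
rewrite /pushforward/=.
have -> : +%R s @^-1` `]a, b] = `]a - s, b - s]%classic.
  by apply/seteqP; split => x /=; rewrite !in_itv/= ltrBlDl lerBrDl.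
rewrite !lebesgue_measure_itv/= !lte_fin ltrD2r.
by case: ifP => // _; rewrite -!EFinD; congr EFin; ring.
Qed.

Lemma laplace_prob_shiftE (b s : R) (A : set R) : 0 < b -> measurable A ->
  laplace_prob b [set x | A (s + x)] =
  (\int[mu]_(x in A) (laplace_pdf b (x - s))%:E)%E.
Proof.
move=> b0 mA; rewrite /laplace_prob b0.
have ms : measurable_fun setT (+%R s : R -> measurableTypeR R).
  exact: measurable_funD.
transitivity (\int[mu]_(x in +%R s @^-1` A)
    ((fun y => (laplace_pdf b (y - s))%:E) \o +%R s) x)%E.
  by apply: eq_integral => x _ /=; rewrite addrC addKr.
transitivity (\int[pushforward mu (+%R s : _ -> measurableTypeR R)]_(x in A)
    (laplace_pdf b (x - s))%:E)%E; last first.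
  by apply: eq_measure_integral => B mB _; exact: lebesgue_measure_shift.
have H := @ge0_integral_pushforward _ _ (measurableTypeR R) (measurableTypeR R)
  R _ ms mu A (fun x => (laplace_pdf b (x - s))%:E).
apply/esym; apply: H => //.
- apply/measurable_funTS/measurableT_comp => //.
  apply: (@measurableT_comp _ _ _ _ _ _ (laplace_pdf b)).
    exact: measurable_laplace_pdf.
  exact: measurable_funD.
- by move=> y _; rewrite lee_fin laplace_pdf_ge0.
Qed.

Lemma laplace_pdf_ratio (b x y : R) : 0 < b ->
  laplace_pdf b x <= expR (`|x - y| / b) * laplace_pdf b y.
Proof.
move=> b0; rewrite /laplace_pdf mulrCA ler_pM2l; last first.
  by rewrite invr_gt0 mulr_gt0.
rewrite -expRD ler_expR -mulrBl -mulNr ler_pM2r ?invr_gt0//.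
have := ler_normB x (x - y); rewrite opprB addrC subrK; lra.
Qed.

Lemma laplace_shift (b s s' : R) (A : set R) : 0 < b -> measurable A ->
  (laplace_prob b [set x | A (s + x)%R] <=
   (expR (`|s - s'| / b))%:E * laplace_prob b [set x | A (s' + x)%R])%E.
Proof.
move=> b0 mA; rewrite !laplace_prob_shiftE//.
have mpdf (t : R) : measurable_fun A (fun x : R => (laplace_pdf b (x - t)%R)%:E).
  apply/measurable_funTS/measurableT_comp => //.
  apply: (@measurableT_comp _ _ _ _ _ _ (laplace_pdf b)).
    exact: measurable_laplace_pdf.
  exact: measurable_funD.
rewrite -ge0_integralZl//.
- apply: ge0_le_integral => //.
  + by move=> x _; rewrite lee_fin laplace_pdf_ge0.
  + exact: mpdf.
  + exact: measurable_funeM (mpdf s').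
  + move=> x _; rewrite -EFinM lee_fin.
    have := laplace_pdf_ratio (x - s) (x - s') b0.
    by rewrite (_ : x - s - (x - s') = s' - s); [rewrite distrC|ring].
- exact: mpdf.
- by move=> x _; rewrite lee_fin laplace_pdf_ge0.
Qed.

Lemma laplace_prob_ge0 (b : R) : 0 < b ->
  laplace_prob b `[0, +oo[%classic = (2^-1)%:E.
Proof.
move=> b0; rewrite /laplace_prob b0 set_itvE.
have := integral_laplace_pdf b0.
rewrite ge0_symfun_integralT; last 3 first.
- by move=> x; exact: laplace_pdf_ge0.
- exact: continuous_laplace_pdf.
- by move=> x; rewrite /laplace_pdf /= normrN.
set I := (\int[_]_(_ in _) _)%E; move=> I1.
have I0 : (0 <= I)%E.
  by apply: integral_ge0 => x _; rewrite lee_fin laplace_pdf_ge0.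
case: I I0 I1 => [r| |]//= r0.
  by rewrite -EFinM => -[h]; congr EFin; lra.
by rewrite mulry gtr0_sg// mul1e.
Qed.

(** A one-sided refinement of [laplace_shift]: when [t'] lies far above [theta], exceeding [theta]
    is already almost certain and a larger [t] gains little. The exponential decay in [t' - theta]
    makes the losses summable along a path. *)
Lemma laplace_upper_tail (b theta t t' : R) : 0 < b ->
  theta < t' -> t <= t' + 2 ->
  (laplace_prob b [set x | (theta < t + x)%R] <=
   (expR (2 / b * expR (- ((t' - theta) / b))))%:E *
   laplace_prob b [set x | (theta < t' + x)%R])%E.
Proof.
move=> b0 tht' tt'.
have le1 : (1 <= (expR (2 / b * expR (- ((t' - theta) / b))))%:E :> \bar R)%E.
  rewrite lee_fin -expR0 ler_expR mulr_ge0 ?expR_ge0//.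
  by rewrite divr_ge0// ltW.
have mS u : measurable [set x : R | theta < u + x].
  have -> : [set x : R | theta < u + x] = `]theta - u, +oo[%classic.
    by apply/seteqP; split => x /=; rewrite in_itv/= andbT ltrBlDl.
  exact: measurable_itv.
have [le_tt'|lt_tt'] := leP t t'.
  rewrite -[leLHS]mul1e; apply: lee_pmul => //; apply: le_measure.
  - by rewrite inE; exact: mS.
  - by rewrite inE; exact: mS.
  - by move=> x /= h; apply: (lt_le_trans h); rewrite lerD2r.
(* As [theta < t'], the event contains the nonnegative half-line. *)
have half : ((2^-1)%:E <= laplace_prob b [set x | (theta < t' + x)%R])%E.
  rewrite -(laplace_prob_ge0 b0); apply: le_measure.
  - by rewrite inE; exact: measurable_itv.
  - by rewrite inE; exact: mS.
  - by move=> x /=; rewrite in_itv/= andbT => x0; lra.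
have E : [set x : R | theta < t + x] =
    `]theta - t, theta - t']%classic `|` [set x : R | theta < t' + x].
  apply/seteqP; split => x /=; rewrite in_itv/=.
    by move=> h; case: (ltP theta (t' + x)) => h'; [right|left; lra].
  by case=> [/andP[]|]; lra.
(* The two events differ by a strip of width at most 2, and the smaller one has
   probability at least 1/2. *)
have strip : (laplace_prob b `](theta - t)%R, (theta - t')%R]%classic <=
    (b^-1 * expR (- ((t' - theta) / b)))%:E)%E.
  rewrite {1}/laplace_prob b0.
  apply: (@le_trans _ _ (\int[mu]_(x in `](theta - t)%R, (theta - t')%R])
      ((2 * b)^-1 * expR (- ((t' - theta) / b)))%:E)%E).
    apply: ge0_le_integral => //.
    - by move=> x _; rewrite lee_fin laplace_pdf_ge0.
    - apply/measurable_funTS/measurableT_comp => //.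
      exact: measurable_laplace_pdf.
    (* The strip lies to the left of 0, so the density is largest at its right end [theta - t']. *)
    - move=> x /=; rewrite in_itv/= => /andP[_ xle]; rewrite lee_fin.
      rewrite ler_pM2l ?invr_gt0 ?mulr_gt0// ler_expR lerN2.
      rewrite ler_pM2r ?invr_gt0// ler0_norm; lra.
  rewrite integral_cst//= lebesgue_measure_itv/= lte_fin.
  rewrite ifT; last by lra.
  rewrite -EFinD -EFinM lee_fin.
  have -> : b^-1 * expR (- ((t' - theta) / b)) =
    (2 * b)^-1 * expR (- ((t' - theta) / b)) * 2 by field; rewrite gt_eqF.
  rewrite ler_pM2l; first lra.
  by rewrite mulr_gt0 ?expR_gt0// invr_gt0 mulr_gt0.
rewrite E; apply: (le_trans (measureU2 (laplace_prob b) _ _)) => //.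
(* With [r] for the exponent, the strip has mass at most [r / 2], hence at most [r] times that of
   the smaller event; [1 + r <= expR r] concludes. *)
apply: (@le_trans _ _
  ((1 + 2 / b * expR (- ((t' - theta) / b)))%:E *
   laplace_prob b [set x | (theta < t' + x)%R])%E); last first.
  by rewrite lee_wpmul2r// lee_fin expR_ge1Dx.
have r0 : 0 <= 2 / b * expR (- ((t' - theta) / b)).
  by rewrite mulr_ge0 ?expR_ge0// divr_ge0// ltW.
rewrite EFinD ge0_muleDl ?lee_fin//.
rewrite mul1e addeC leeD2l//; apply: (le_trans strip).
have -> : b^-1 * expR (- ((t' - theta) / b)) =
  2 / b * expR (- ((t' - theta) / b)) * 2^-1 by field; rewrite gt_eqF.
by rewrite (EFinM _ 2^-1) lee_wpmul2l.
Qed.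

End laplace_shift.

(** * Vectors of independent Laplace noises *)

Section laplace_tuple.
Context (R : realType).

Lemma laplace_shift_integral (b s s' : R) (f : R -> \bar R) : 0 < b ->
  measurable_fun setT f -> (forall x, 0 <= f x)%E ->
  (\int[laplace_prob b]_x f (s + x)%R <=
   (expR (`|s - s'| / b))%:E * \int[laplace_prob b]_x f (s' + x)%R)%E.
Proof.
move=> b0 mf f0.
have ms (u : R) : measurable_fun setT (+%R u : R -> R).
  exact: measurable_funD.
have E (u : R) : (\int[laplace_prob b]_x f (u + x)%R =
    \int[giry_map (ms u) (laplace_prob b)]_x f x)%E.
  by rewrite [RHS](ge0_integral_pushforward (ms u)).
rewrite !E; apply: exp_dominated_integral => // Z mZ.
exact: laplace_shift.
Qed.

Lemma laplace_tupleS (b : R) n (V : set (n.+1.-tuple R)) : measurable V ->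
  laplace_tuple b n.+1 V =
  (\int[laplace_prob b]_x laplace_tuple b n [set z : n.-tuple R | V [tuple of x :: z]])%E.
Proof.
move=> mV /=; rewrite /giry_map /pushforward /giry_prod /=.
rewrite /product_measure1.
apply: eq_integral => x _ /=; congr (laplace_tuple b n _).
by apply/seteqP; split => z /=; rewrite /xsection/= inE.
Qed.

Lemma measurable_shift_tuple n (s : 'I_n -> R) :
  measurable_fun setT (fun z : n.-tuple R => [tuple s i + tnth z i | i < n]).
Proof.
apply/measurable_fun_tnthP => i.
rewrite [X in measurable_fun _ X](_ : _ = fun z => s i + tnth z i).
  by apply: measurable_funD; [exact: measurable_cst|exact: measurable_tnth].
by apply/funext => z /=; rewrite tnth_mktuple.
Qed.

(** Induction on the length: [laplace_tupleS] isolates the first noise, and the shifts of the others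
    are exchanged under the integral before that of the first. *)
Lemma laplace_tuple_shift (b : R) n (s s' : 'I_n -> R) (W : set (n.-tuple R)) :
  0 < b -> measurable W ->
  (laplace_tuple b n [set z : n.-tuple R | W [tuple (s i + tnth z i)%R | i < n]] <=
   (expR (\sum_(i < n) `|s i - s' i| / b))%:E *
   laplace_tuple b n [set z : n.-tuple R | W [tuple (s' i + tnth z i)%R | i < n]])%E.
Proof.
move=> b0; elim: n s s' W => [|n IH] s s' W mW.
  rewrite big_ord0 expR0 mul1e.
  rewrite (_ : [set _ | _] = [set z : 0.-tuple R | W [tuple s' i + tnth z i | i < 0]])//.
  by apply/seteqP; split => z /=; rewrite !(tuple0 [tuple _ | _ < _]).
have mshift (u : 'I_n.+1 -> R) :
    measurable [set z : n.+1.-tuple R | W [tuple u i + tnth z i | i < n.+1]].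
  by have := measurable_shift_tuple u measurableT mW; rewrite setTI; apply.
have consE (u : 'I_n.+1 -> R) (x : R) (z : n.-tuple R) :
    [tuple u i + tnth [tuple of x :: z] i | i < n.+1] =
    [tuple of (u ord0 + x) :: [tuple u (lift ord0 i) + tnth z i | i < n]].
  apply: eq_from_tnth => i; rewrite tnth_mktuple.
  case: (unliftP ord0 i) => [j ->|->]; last by rewrite !tnth0.
  by rewrite !tnthS tnth_mktuple.
have mWy (y : R) : measurable [set t : n.-tuple R | W [tuple of y :: t]].
  have := measurable_cons (measurable_cst y) (@measurable_id _ _ setT) measurableT mW.
  by rewrite setTI.
pose H (u : 'I_n -> R) (y : R) := laplace_tuple b n
  [set z : n.-tuple R | W [tuple of y :: [tuple u i + tnth z i | i < n]]].
(* [H u] gives the masses of the sections of a measurable set of the product. *)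
have mH u : measurable_fun setT (H u).
  pose V := [set p : R * n.-tuple R |
    W [tuple of p.1 :: [tuple u i + tnth p.2 i | i < n]]].
  have mV : measurable V.
    have m2 : measurable_fun setT
        (fun p : R * n.-tuple R => [tuple u i + tnth p.2 i | i < n]).
      exact: (measurableT_comp (measurable_shift_tuple u) measurable_snd).
    have := measurable_cons measurable_fst m2 measurableT mW.
    by rewrite setTI.
  have := measurable_fun_xsection (laplace_tuple b n) mV.
  apply: eq_measurable_fun => y _ /=; rewrite /H; congr (laplace_tuple b n _).
  by apply/seteqP; split => z /=; rewrite /xsection/= inE.
have HE (u : 'I_n.+1 -> R) :
    laplace_tuple b n.+1 [set z | W [tuple (u i + tnth z i)%R | i < n.+1]] =
    (\int[laplace_prob b]_x H (fun i => u (lift ord0 i)) (u ord0 + x)%R)%E.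
  rewrite laplace_tupleS//; apply: eq_integral => x _; rewrite /H.
  congr (laplace_tuple b n _); apply/seteqP; split => z /=.
    by rewrite consE.
  by rewrite -consE.
rewrite !HE big_ord_recl expRD EFinM -muleA.
apply: (@le_trans _ _ (\int[laplace_prob b]_x
  ((expR (\sum_(i < n) `|s (lift ord0 i) - s' (lift ord0 i)| / b))%:E *
   H (fun i => s' (lift ord0 i)) (s ord0 + x)%R))%E).
  apply: ge0_le_integral => //.
  - by apply: measurableT_comp => //; exact: measurable_funD.
  - apply: measurable_funeM; apply: (measurableT_comp (mH _)).
    exact: measurable_funD.
  - by move=> x _; exact: (IH _ _ _ (mWy _)).
rewrite [leLHS]ge0_integralZl//; last first.
  by apply: (measurableT_comp (mH _)); exact: measurable_funD.
rewrite muleCA lee_pmul2l ?lte_fin ?expR_gt0//.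
exact: laplace_shift_integral.
Qed.

End laplace_tuple.

(** * Aggregation error and cuts *)

Section deviation.
Context (R : realType) (T : finType).
Implicit Types (A : {set T}) (f : T -> R).

Definition mean A f : R := (\sum_(c in A) f c) / #|A|%:R.

Definition deviation A f : R := \sum_(c in A) `|f c - mean A f|.

Lemma sum_sub_mean A f : \sum_(c in A) (f c - mean A f) = 0.
Proof.
rewrite sumrB sumr_const; have [/eqP|A0] := posnP #|A|.
  by rewrite cards_eq0 => /eqP ->; rewrite cards0 mulr0n big_set0 subrr.
by rewrite -mulr_natr divfK ?subrr// pnatr_eq0 -lt0n.
Qed.

(** As the signed deviations add up to 0, adding them to their absolute values changes nothing, and
    [|x| + x] is twice the positive part of [x]. *)
Lemma deviation_pos A f :
  deviation A f = 2 * \sum_(c in A) Num.max 0 (f c - mean A f).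
Proof.
rewrite -[LHS]addr0 -[X in _ + X = _](sum_sub_mean A f) /deviation.
rewrite -big_split/= mulr_sumr.
apply: eq_bigr => c _; case: (lerP 0 (f c - mean A f)) => h.
  by rewrite ger0_norm//; lra.
by rewrite ltr0_norm//; lra.
Qed.

Lemma deviationN A f : deviation A (fun c => - f c) = deviation A f.
Proof.
by apply: eq_bigr => c _; rewrite /mean sumrN mulNr -opprD normrN.
Qed.

Lemma deviation_subset A A' f : A \subset A' ->
  deviation A f <= deviation A' f.
Proof.
move=> sAA'.
(* Passing to [- f] if needed, the mean over [A] is the larger one, and then
   each positive part only increases when [A] is replaced by [A']. *)
have key g : mean A' g <= mean A g -> deviation A g <= deviation A' g.
  move=> le_mean; rewrite !deviation_pos ler_pM2l//.
  rewrite [leRHS](big_setID A)/= (finset.setIidPr sAA') -[leLHS]addr0.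
  apply: lerD; last by apply: sumr_ge0 => c _; rewrite le_max lexx.
  apply: ler_sum => c _; rewrite ge_max le_max lexx/= le_max; apply/orP; right.
  by lra.
have [|lt_mean] := leP (mean A' f) (mean A f); first exact: key.
rewrite -(deviationN A) -(deviationN A'); apply: key.
by rewrite /mean !sumrN !mulNr lerN2 ltW.
Qed.

(** With [n] cells, a change by [t] at [c] moves the mean by [t / n]: the term at [c] moves by at
    most [|t| * (1 - 1 / n)], and the [n - 1] others by at most [|t| / n] each. *)
Lemma deviation_sensitivity A f g c : c \in A ->
  (forall c', c' != c -> f c' = g c') -> `|f c - g c| <= 1 ->
  `|deviation A f - deviation A g| <= 2 * (1 - #|A|%:R^-1).
Proof.
move=> cA fg fgc.
have A0 : (0 < #|A|)%N by apply/card_gt0P; exists c.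
have n1 : 1 <= #|A|%:R :> R by rewrite ler1n.
have n0 : #|A|%:R != 0 :> R by rewrite pnatr_eq0 -lt0n.
set t := f c - g c.
have dmean : mean A f - mean A g = t / #|A|%:R.
  rewrite /mean -mulrBl -sumrB (bigD1 c)//= big1 ?addr0// => c' /andP[_ c'c].
  by rewrite fg// subrr.
rewrite /deviation -sumrB; apply: (le_trans (ler_norm_sum _ _ _)).
rewrite (bigD1 c)//=.
have le1 : `| `|f c - mean A f| - `|g c - mean A g| | <= 1 - #|A|%:R^-1.
  apply: (le_trans (ler_dist_dist _ _)).
  have -> : f c - mean A f - (g c - mean A g) = t * (1 - #|A|%:R^-1).
    by rewrite mulrBr mulr1 -dmean /t; ring.
  rewrite normrM [X in _ * X]ger0_norm; last by rewrite subr_ge0 invf_le1 ?ltr0n.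
  by rewrite ler_piMl// subr_ge0 invf_le1 ?ltr0n.
have le2 : \sum_(i in A | i != c)
    `| `|f i - mean A f| - `|g i - mean A g| | <= 1 - #|A|%:R^-1.
  apply: (@le_trans _ _ (\sum_(i in A | i != c) #|A|%:R^-1)).
    apply: ler_sum => i /andP[_ ic]; apply: (le_trans (ler_dist_dist _ _)).
    rewrite fg// (_ : _ - _ - _ = - (mean A f - mean A g)); last by ring.
    by rewrite normrN dmean normrM normfV normr_nat ler_piMl.
  rewrite (eq_bigl (mem (A :\ c)%SET)); last by move=> i; rewrite !inE andbC.
  rewrite sumr_const -[_ *+ _]mulr_natr.
  have : #|A| = #|(A :\ c)%SET|.+1 by rewrite (cardsD1 c) cA.
  move=> E; have -> : #|(A :\ c)%SET|%:R = #|A|%:R - 1 :> R.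
    by rewrite E -natr1 addrK.
  by rewrite mulrBr mulVf// mulr1.
have -> : 2 * (1 - #|A|%:R^-1) = (1 - #|A|%:R^-1) + (1 - #|A|%:R^-1) :> R by ring.
exact: lerD.
Qed.

End deviation.

(** * Cells of the two halves of a cut, and the cell where neighbors differ *)

Section cells.
Context (d : nat) (disp : Order.disp_t) (dom : 'I_d -> finTBOrderType disp).
Implicit Types (B : block dom) (p : cutpoint dom) (X Y : database dom).

Lemma AE_deviation (R : realType) X B :
  AE R X B = deviation (cells B) (fun c => (X c)%:R).
Proof. by rewrite /AE /deviation /mean /block_sum natr_sum. Qed.

Lemma next_value_gt i (v : dom i) : (v < \top)%O -> (v < next_value v)%O.
Proof.
by move=> vt; rewrite /next_value; case: Order.TotalTheory.arg_minP.
Qed.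

Lemma cellsP B (c : cell dom) :
  reflect (forall i, B.1 i <= c i <= B.2 i)%O (c \in cells B).
Proof. by rewrite inE; exact: forallP. Qed.

Lemma cells_cutl B p : p \in cuts B ->
  cells (cutl B p) \subset [set c in cells B | (c (tag p) <= tagged p)%O]%SET.
Proof.
move=> pB; apply/fintype.subsetP => c /cellsP h; rewrite inE.
move: pB; rewrite inE => /andP[lp pu].
have hp : (c (tag p) <= tagged p)%O.
  by have /andP[_] := h (tag p); rewrite /= ffunE dfwithin.
rewrite hp andbT; apply/cellsP => i; have /andP[-> /=] := h i.
rewrite /set_value ffunE; case: dfwithP => //= cp.
exact: le_trans cp (ltW pu).
Qed.

Lemma cells_cutr B p : p \in cuts B ->
  cells (cutr B p) \subset [set c in cells B | (tagged p < c (tag p))%O]%SET.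
Proof.
move=> pB; apply/fintype.subsetP => c /cellsP h; rewrite inE.
move: pB; rewrite inE => /andP[lp pu].
have vn := next_value_gt (lt_le_trans pu (lex1 _)).
have hp : (tagged p < c (tag p))%O.
  have /andP[+ _] := h (tag p); rewrite /= ffunE dfwithin.
  exact: lt_le_trans.
rewrite hp andbT; apply/cellsP => i; have /andP[+ ->] := h i.
rewrite andbT/= /set_value ffunE; case: dfwithP => //= pc.
by apply: le_trans pc; apply: (le_trans lp); exact: ltW.
Qed.

Lemma cells_cut_disjoint B p (c : cell dom) : p \in cuts B ->
  c \in cells (cutl B p) -> c \notin cells (cutr B p).
Proof.
move=> pB /(fintype.subsetP (cells_cutl pB)); rewrite inE => /andP[_ h].
apply/negP => /(fintype.subsetP (cells_cutr pB)); rewrite inE => /andP[_].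
by rewrite ltNge h.
Qed.

Lemma cells_cutl_subset B p : p \in cuts B -> cells (cutl B p) \subset cells B.
Proof.
move=> pB; apply: (fintype.subset_trans (cells_cutl pB)).
by apply/fintype.subsetP => c; rewrite inE => /andP[].
Qed.

Lemma cells_cutr_subset B p : p \in cuts B -> cells (cutr B p) \subset cells B.
Proof.
move=> pB; apply: (fintype.subset_trans (cells_cutr pB)).
by apply/fintype.subsetP => c; rewrite inE => /andP[].
Qed.

(** A symmetric form of [neighbor] with the cell named: it covers addition, removal and equality at
    once, and membership of [c] separates the affected blocks from the others. *)
Definition differ_at (c : cell dom) X Y : Prop :=
  (forall c', c' != c -> X c' = Y c') /\ (X c <= (Y c).+1)%N /\ (Y c <= (X c).+1)%N.

Lemma neighbor_differ_at X Y : neighbor X Y -> exists c, differ_at c X Y.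
Proof.
have add c Z : differ_at c Z (add_record c Z).
  split=> [c' c'c|]; rewrite ffunE; first by rewrite (negbTE c'c) addn0.
  by rewrite eqxx addn1; split; rewrite ?leqnSn// ltnW.
case=> [->|[c [->|->]]].
- by exists [ffun=> \bot%O]; split.
- by exists c.
- by exists c; have [h [h1 h2]] := add c Y; split=> // c' /h.
Qed.

Lemma differ_atC c X Y : differ_at c X Y -> differ_at c Y X.
Proof. by move=> [h [h1 h2]]; split=> // c' /h. Qed.

Lemma differ_at_dist (R : realType) c X Y :
  differ_at c X Y -> `|(X c)%:R - (Y c)%:R| <= 1 :> R.
Proof.
move=> [_ [h1 h2]]; rewrite ler_norml lerBrDl lerBlDl.
move: h1 h2; rewrite -!(ler_nat R) -!natr1; lra.
Qed.

End cells.

(** * Privacy of the recursive bisection *)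

Section AE.
Context (R : realType) (d : nat) (disp : Order.disp_t).
Context (dom : 'I_d -> finTBOrderType disp).
Implicit Types (B : block dom) (p : cutpoint dom) (X Y : database dom).

Lemma AE_subset X B B' : cells B' \subset cells B -> AE R X B' <= AE R X B.
Proof. by move=> sB; rewrite !AE_deviation; exact: deviation_subset. Qed.

Lemma eq_AE c X Y B : differ_at c X Y -> c \notin cells B -> AE R X B = AE R Y B.
Proof.
move=> [XY _] cB; rewrite !AE_deviation.
have E c' : c' \in cells B -> X c' = Y c'.
  by move=> c'B; apply: XY; apply: contraNneq cB => <-.
have Em : mean (cells B) (fun c => (X c)%:R : R) =
    mean (cells B) (fun c => (Y c)%:R).
  by rewrite /mean; congr (_ / _); apply: eq_bigr => c' /E ->.
by rewrite /deviation Em; apply: eq_bigr => c' /E ->.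
Qed.

Lemma AE_sensitivity c X Y B : differ_at c X Y -> c \in cells B ->
  `|AE R X B - AE R Y B| <= sensAE R B.
Proof.
move=> XY cB; rewrite !AE_deviation /sensAE.
apply: (deviation_sensitivity cB); last exact: differ_at_dist XY.
by move=> c' /XY.1 ->.
Qed.

(** The cell [c] keeps [B'] nonempty: as the inverse of 0 is 0, an empty block would get the value
    2. *)
Lemma sensAE_subset c B B' : cells B' \subset cells B -> c \in cells B' ->
  sensAE R B' <= sensAE R B.
Proof.
move=> sB cB'; rewrite /sensAE ler_pM2l// lerD2l lerN2.
have B'0 : (0 < #|cells B'|)%N by apply/card_gt0P; exists c.
rewrite lef_pV2 ?posrE ?ltr0n// ?ler_nat ?subset_leq_card//.
by apply: leq_trans B'0 _; exact: subset_leq_card.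
Qed.

Lemma sensAE_ge0 c B : c \in cells B -> 0 <= sensAE R B.
Proof.
move=> cB; have B0 : (0 < #|cells B|)%N by apply/card_gt0P; exists c.
by rewrite /sensAE mulr_ge0// subr_ge0 invf_le1 ?ltr0n// ler1n.
Qed.

Lemma sensAE_gt0 c B : c \in cells B -> #|cells B| != 1%N -> 0 < sensAE R B.
Proof.
move=> cB B1; have B0 : (0 < #|cells B|)%N by apply/card_gt0P; exists c.
by rewrite /sensAE mulr_gt0// subr_gt0 invf_lt1 ?ltr0n// ltr1n ltn_neqAle eq_sym B1.
Qed.

Lemma sensAE_le2 B : sensAE R B <= 2.
Proof.
have : 0 <= #|cells B|%:R^-1 :> R by rewrite invr_ge0.
rewrite /sensAE; lra.
Qed.

(** Each half changes by at most [sensAE R B]: smaller nonempty blocks are less sensitive, and a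
    half without [c] does not change. This gives the factor 2 of [sensQ]. *)
Lemma quality_sensitivity c X Y B p : differ_at c X Y -> c \in cells B ->
  p \in cuts B -> `|quality R X B p - quality R Y B p| <= sensQ R B.
Proof.
move=> XY cB pB.
have key B' : cells B' \subset cells B ->
    `|AE R X B' - AE R Y B'| <= sensAE R B.
  move=> sB; have [cB'|cB'] := boolP (c \in cells B').
    by apply: (le_trans (AE_sensitivity XY cB')); exact: sensAE_subset cB'.
  by rewrite (eq_AE XY cB') subrr normr0; exact: sensAE_ge0 cB.
have := key _ (cells_cutl_subset pB); have := key _ (cells_cutr_subset pB).
rewrite /quality /sensQ !ler_norml => /andP[h1 h2] /andP[h3 h4].
by apply/andP; split; lra.
Qed.

Lemma eq_quality c X Y B p : differ_at c X Y -> c \notin cells B ->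
  p \in cuts B -> quality R X B p = quality R Y B p.
Proof.
move=> XY cB pB; rewrite /quality !(eq_AE XY)//.
- by apply: contra cB; exact/fintype.subsetP/cells_cutr_subset.
- by apply: contra cB; exact/fintype.subsetP/cells_cutl_subset.
Qed.

End AE.

(** * Budgets for cuts and convergences, spent along the path of one cell *)

Section bisection.
Context (R : realType) (d : nat) (disp : Order.disp_t).
Context (dom : 'I_d -> finTBOrderType disp).
Context (eps_r eps_p alpha beta gamma : R).
Context (q : nat -> block dom -> cutpoint dom -> {nonneg R}).
Hypotheses (eps_r_gt0 : 0 < eps_r) (alpha_gt1 : 1 < alpha) (beta_gt0 : 0 < beta).
Hypotheses (gamma_gt0 : 0 < gamma) (gamma_le1 : gamma <= 1).
Implicit Types (B : block dom) (p : cutpoint dom) (X Y : database dom).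

Notation lam := (lambda eps_r alpha gamma).
Notation del := (delta eps_r alpha gamma).
Notation th := (theta eps_p).
Notation kap := (kappa dom beta).
Notation epsc := (eps_cut dom eps_r beta gamma).

Let a1 : 0 < alpha - 1. Proof. by rewrite subr_gt0. Qed.

Let a1n : alpha - 1 != 0. Proof. by rewrite gt_eqF. Qed.

(** This is [alpha / (alpha - 1) + 2]: the full geometric series of ratio [1 / alpha], a cost 1 for
    the transition zone, and 1 for the final convergence. The choice of [lambda] makes it worth
    [gamma * eps_r]. *)
Definition max_converge_budget : R := (2 * alpha - 1) / (alpha - 1) + 1.

Lemma lambda_gt0 : 0 < lam.
Proof.
rewrite /lambda mulr_gt0 ?divr_gt0 ?mulr_gt0//.
by rewrite addr_gt0// divr_gt0//; have := alpha_gt1; lra.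
Qed.

Lemma max_converge_budgetE : 2 / lam * max_converge_budget = gamma * eps_r.
Proof.
rewrite /lambda -/max_converge_budget.
have C0 : max_converge_budget != 0.
  by rewrite gt_eqF// addr_gt0// divr_gt0//; have := alpha_gt1; lra.
by field; rewrite C0 !gt_eqF.
Qed.

Lemma delta_gt0 : 0 < del.
Proof. by rewrite /delta mulr_gt0 ?lambda_gt0// ln_gt0. Qed.

Lemma expR_delta : expR (del / lam) = alpha.
Proof.
rewrite /delta mulrAC divff ?mul1r ?gt_eqF ?lambda_gt0//.
by rewrite lnK// posrE; have := alpha_gt1; lra.
Qed.

(* For a block of the path to the modified record, with [u] the larger of its
   two values of [AE - k * delta - theta - 2], the privacy loss of its not
   converging is, in units of [2 / lambda], at most [converge_cost u]; as [u]
   drops by [delta] at every cut, [converge_budget u] bounds the loss of the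
   whole remaining path, including the final convergence. *)
Definition converge_cost (u : R) : R :=
  if u <= - del then 0 else if u <= 0 then 1 else expR (- (u / lam)).

Definition converge_budget (u : R) : R :=
  if u <= - del then 1
  else max_converge_budget - expR (- (u / lam)) / (alpha - 1).

(** Above [- del] the exponential is at most [alpha], and [max_converge_budget] is
    [alpha / (alpha - 1) + 2]. The remaining 2 pays for one step in the transition zone and for the
    final convergence. *)
Lemma converge_budget_ge2 u : - del < u ->
  2 <= max_converge_budget - expR (- (u / lam)) / (alpha - 1).
Proof.
move=> du; have e_le : expR (- (u / lam)) <= alpha.
  rewrite -[leRHS]expR_delta ler_expR -mulNr ler_pM2r ?invr_gt0 ?lambda_gt0//.
  by lra.
have : expR (- (u / lam)) / (alpha - 1) <= alpha / (alpha - 1).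
  by rewrite ler_pM2r ?invr_gt0.
rewrite /max_converge_budget.
have -> : (2 * alpha - 1) / (alpha - 1) = alpha / (alpha - 1) + 1 by field.
lra.
Qed.

Lemma converge_budget_ge1 u : 1 <= converge_budget u.
Proof.
rewrite /converge_budget; case: (leP u) => // du; have := converge_budget_ge2 du; lra.
Qed.

Lemma converge_budget_le u : converge_budget u <= max_converge_budget.
Proof.
rewrite /converge_budget; case: (leP u) => _.
  by rewrite /max_converge_budget lerDr divr_ge0 ?ltW//; have := alpha_gt1; lra.
by rewrite gerBl divr_ge0 ?expR_ge0// ltW.
Qed.

(** Telescoping: a drop of [u] by [del] multiplies the exponential [e] by [alpha], so the subtracted
    term [e / (alpha - 1)] grows by exactly [e], the cost at a positive [u]. From [u <= 0] one lands
    at or below [- del], where only the final convergence remains to be paid. *)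
Lemma converge_budget_step u u' : u' <= u - del ->
  converge_cost u + converge_budget u' <= converge_budget u.
Proof.
move=> u'u; have del0 := delta_gt0.
rewrite /converge_cost /converge_budget.
have [ud|ud] := leP u (- del).
  by rewrite ifT; lra.
have [u0|u0] := leP u 0.
  rewrite ifT; last by lra.
  by have := converge_budget_ge2 ud; lra.
set e := expR (- (u / lam)); have [u'd|u'd] := leP u' (- del).
  (* A larger drop may skip the transition zone; [e <= 1] then suffices. *)
  have e1 : e <= 1.
    by rewrite -expR0 ler_expR oppr_le0 divr_ge0// ltW// lambda_gt0.
  rewrite /max_converge_budget.
  have : e / (alpha - 1) <= 1 / (alpha - 1) by rewrite ler_pM2r ?invr_gt0.
  have -> : (2 * alpha - 1) / (alpha - 1) = 1 / (alpha - 1) + 2 by field.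
  lra.
have : alpha * e <= expR (- (u' / lam)).
  rewrite -[in leLHS]expR_delta -expRD ler_expR -!mulNr -mulrDl.
  rewrite ler_pM2r ?invr_gt0 ?lambda_gt0//; lra.
set e' := expR _ => ee'.
have : alpha * e / (alpha - 1) <= e' / (alpha - 1) by rewrite ler_pM2r ?invr_gt0.
have -> : alpha * e / (alpha - 1) = e / (alpha - 1) + e by field.
lra.
Qed.

Lemma kappa_ge0 : 0 <= kap.
Proof.
rewrite /kappa mulr_ge0 ?(ltW beta_gt0)// divr_ge0// ln_ge0 ?ler1n//.
by rewrite prodn_gt0// => i; apply/card_gt0P; exists \bot%O.
Qed.

Lemma eps_cut_ge0 : 0 <= epsc.
Proof. by rewrite /eps_cut divr_ge0 ?kappa_ge0// mulr_ge0 ?subr_ge0// ltW. Qed.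

Definition cut_cost (k : nat) : R := if k%:R <= kap then epsc else 0.

(** As [kap] is real, [kap - k + 1] only bounds from above the number of depths from [k] to
    [kap]. *)
Definition cut_budget (k : nat) : R := epsc * Num.max 0 (kap - k%:R + 1).

Lemma cut_budget_ge0 k : 0 <= cut_budget k.
Proof. by rewrite mulr_ge0 ?eps_cut_ge0// le_max lexx. Qed.

Lemma cut_budget_step k : cut_cost k + cut_budget k.+1 <= cut_budget k.
Proof.
rewrite /cut_cost /cut_budget; case: (leP _ kap) => kk.
  rewrite -[X in X + _]mulr1 -mulrDr ler_wpM2l ?eps_cut_ge0// -natr1.
  rewrite le_max; apply/orP; right; rewrite -lerBrDl ge_max.
  by apply/andP; split; lra.
rewrite add0r ler_wpM2l ?eps_cut_ge0// ge_max le_max lexx/= le_max.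
by apply/orP; right; rewrite -natr1; lra.
Qed.

Lemma cut_budget1 : cut_budget 1 <= (1 - gamma) * eps_r.
Proof.
have g0 : 0 <= (1 - gamma) * eps_r by rewrite mulr_ge0 ?subr_ge0// ltW.
rewrite /cut_budget subrK; have := kappa_ge0; rewrite le_eqVlt => /predU1P[<-|k0].
  (* Here [kap = 0], as for a domain with a single cell, and the budget vanishes whatever the value
     of the quotient defining [eps_cut]. *)
  by rewrite maxxx mulr0.
by rewrite max_r ?(ltW k0)// /eps_cut divfK// gt_eqF.
Qed.

Definition excess X Y (k : nat) B : R :=
  Num.max (AE R X B) (AE R Y B) - k%:R * del - th - 2.

Lemma BAE_dist c X Y k B : differ_at c X Y -> c \in cells B ->
  `|BAE eps_r eps_p alpha gamma X k B - BAE eps_r eps_p alpha gamma Y k B| <= 2.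
Proof.
move=> XY cB; have := le_trans (AE_sensitivity R XY cB) (sensAE_le2 R B).
rewrite /BAE !ler_norml => /andP[h1 h2]; set z := th + 2 - del.
by apply/andP; split; case: (leP z (AE R X B - _)); case: (leP z (AE R Y B - _)); lra.
Qed.

Lemma random_convergeE X k B (b : bool) :
  random_converge eps_r eps_p alpha gamma X k B [set b] =
  laplace_prob lam [set z | (BAE eps_r eps_p alpha gamma X k B + z <= th)%R = b].
Proof. by []. Qed.

Lemma converge_dominated c X Y k B (b : bool) : differ_at c X Y -> c \in cells B ->
  (random_converge eps_r eps_p alpha gamma X k B [set b] <=
   (expR (2 / lam))%:E * random_converge eps_r eps_p alpha gamma Y k B [set b])%E.
Proof.
move=> XY cB; rewrite !random_convergeE.
apply: (@le_trans _ _ _ _ _ (@laplace_shift _ lam _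
    (BAE eps_r eps_p alpha gamma Y k B) [set z | (z <= th) = b] lambda_gt0 _)).
  have := @measurable_fun_ler _ _ _ setT id (cst th) (@measurable_id _ _ _)
    (measurable_cst _) measurableT [set b] I.
  by rewrite setTI.
rewrite lee_wpmul2r// lee_fin ler_expR ler_pM2r ?invr_gt0 ?lambda_gt0//.
exact: BAE_dist XY cB.
Qed.

Lemma not_converge_dominated c X Y k B : differ_at c X Y -> c \in cells B ->
  (random_converge eps_r eps_p alpha gamma X k B [set false] <=
   (expR (2 / lam * converge_cost (excess X Y k B)))%:E *
   random_converge eps_r eps_p alpha gamma Y k B [set false])%E.
Proof.
move=> XY cB; have l0 := lambda_gt0; rewrite /converge_cost.
have := le_trans (AE_sensitivity R XY cB) (sensAE_le2 R B).
rewrite ler_norml => /andP[h1 h2].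
have excX : AE R X B - k%:R * del - th - 2 <= excess X Y k B.
  by rewrite !lerD2r le_max lexx.
have excY : AE R Y B - k%:R * del - th - 2 <= excess X Y k B.
  by rewrite !lerD2r le_max lexx orbT.
(* The 2 subtracted in [excess] absorbs the sensitivity, so even the smaller of the two values lies
   above [th] by at least [excess]. *)
have excY' : excess X Y k B <= AE R Y B - k%:R * del - th.
  by rewrite /excess; case: (leP (AE R X B) (AE R Y B)); lra.
have [ud|ud] := leP (excess X Y k B) (- del).
  (* Both values of [BAE] are at the floor [th + 2 - del], so the two laws coincide. *)
  rewrite mulr0 expR0 mul1e !random_convergeE /BAE.
  by rewrite !max_l//; lra.
have [u0|u0] := leP (excess X Y k B) 0.
  by rewrite mulr1; exact: converge_dominated XY cB.
rewrite !random_convergeE.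
have E Z : [set z | (BAE eps_r eps_p alpha gamma Z k B + z <= th) = false] =
    [set z | th < BAE eps_r eps_p alpha gamma Z k B + z].
  by apply/seteqP; split => z /=; rewrite ltNge; [move=> ->|move=> /negbTE].
have YB : excess X Y k B <= BAE eps_r eps_p alpha gamma Y k B - th.
  have : AE R Y B - k%:R * del <= BAE eps_r eps_p alpha gamma Y k B.
    by rewrite /BAE le_max lexx orbT.
  lra.
have Yth : th < BAE eps_r eps_p alpha gamma Y k B by lra.
have BXY : BAE eps_r eps_p alpha gamma X k B <=
    BAE eps_r eps_p alpha gamma Y k B + 2.
  by rewrite -lerBlDl; apply: le_trans (BAE_dist k XY cB); exact: ler_norm.
rewrite !E; apply: (le_trans (laplace_upper_tail l0 Yth BXY)).
rewrite lee_wpmul2r// lee_fin ler_expR ler_pM2l ?divr_gt0//.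
by rewrite ler_expR lerN2 ler_pM2r ?invr_gt0.
Qed.

Lemma converge_outside c X Y k B (b : bool) : differ_at c X Y -> c \notin cells B ->
  random_converge eps_r eps_p alpha gamma X k B [set b] =
  random_converge eps_r eps_p alpha gamma Y k B [set b].
Proof. by move=> XY cB; rewrite !random_convergeE /BAE (eq_AE R XY cB). Qed.

(** Up to depth [kap] this is the exponential mechanism; beyond it, both databases draw the cut from
    the same law. *)
Lemma random_cut_dominated c X Y k B dO (O : measurableType dO)
    (f f' : cutpoint dom -> giry O R) (e : R) :
  differ_at c X Y -> c \in cells B -> #|cells B| != 1%N ->
  (forall p, p \in cuts B -> exp_dominated e (f p) (f' p)) ->
  exp_dominated (cut_cost k + e)
    (random_cut eps_r beta gamma q X k B f) (random_cut eps_r beta gamma q Y k B f').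
Proof.
move=> XY cB B1 ff'; rewrite /random_cut /cut_cost; case: ifP => _.
  apply: draw_exp_dominated => // p pB /=.
  have sQ : 0 < sensQ R B by rewrite /sensQ mulr_gt0// (sensAE_gt0 _ cB).
  have s2Q : 0 < 2 * sensQ R B by rewrite pmulr_rgt0.
  have key X' Y' p' : differ_at c X' Y' -> p' \in cuts B ->
      expR (epsc * quality R X' B p' / (2 * sensQ R B)) <=
      expR (epsc / 2) * expR (epsc * quality R Y' B p' / (2 * sensQ R B)).
    move=> XY' p'B; rewrite -expRD ler_expR -lerBlDr -mulrBl -mulrBr.
    rewrite ler_pdivrMr// (mulrA (epsc / 2)) divfK// ler_wpM2l ?eps_cut_ge0//.
    have := quality_sensitivity R XY' cB p'B.
    exact/le_trans/ler_norm.
  apply: (@exponential_mechanism _ _ (cuts B)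
    (fun p => expR (epsc * quality R X B p / (2 * sensQ R B)))
    (fun p => expR (epsc * quality R Y B p / (2 * sensQ R B)))) => //.
  - by move=> p'; exact: expR_gt0.
  - by move=> p'; exact: expR_gt0.
  - by move=> p'; exact: key.
  - by move=> p'; exact/key/differ_atC.
apply: draw_exp_dominated => // p _.
by rewrite expR0 mul1r.
Qed.

Lemma random_cut_outside c X Y k B dO (O : measurableType dO)
    (f f' : cutpoint dom -> giry O R) (e : R) :
  differ_at c X Y -> c \notin cells B ->
  (forall p, p \in cuts B -> exp_dominated e (f p) (f' p)) ->
  exp_dominated e
    (random_cut eps_r beta gamma q X k B f) (random_cut eps_r beta gamma q Y k B f').
Proof.
move=> XY cB ff'; rewrite -[e]add0r /random_cut; case: ifP => _.
  apply: draw_exp_dominated => // p pB; rewrite expR0 mul1r.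
  have wE p' : p' \in cuts B -> (exp_weight eps_r beta gamma X B p')%:num =
      (exp_weight eps_r beta gamma Y B p')%:num.
    by move=> p'B /=; rewrite (eq_quality R XY cB p'B).
  by rewrite wE// (eq_bigr _ wE).
by apply: draw_exp_dominated => // p _; rewrite expR0 mul1r.
Qed.

(** Vanishing on the blocks without [c] lets the budgets of two halves simply be added, as
    composition requires. *)
Definition path_budget c X Y (k : nat) B : R :=
  if c \in cells B
  then cut_budget k + 2 / lam * converge_budget (excess X Y k B) else 0.

Lemma path_budget_ge0 c X Y k B : 0 <= path_budget c X Y k B.
Proof.
rewrite /path_budget; case: ifP => // _; rewrite addr_ge0 ?cut_budget_ge0//.
rewrite mulr_ge0 ?divr_ge0 ?(ltW lambda_gt0)//.
exact: le_trans ler01 (converge_budget_ge1 _).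
Qed.

(** The halves are disjoint, so at most one has a nonzero budget; there [AE] has not grown while the
    depth has, so [excess] has dropped by at least [del]. *)
Lemma path_budget_cut c X Y k B p : c \in cells B -> p \in cuts B ->
  2 / lam * converge_cost (excess X Y k B) +
  (cut_cost k + (path_budget c X Y k.+1 (cutl B p) +
                 path_budget c X Y k.+1 (cutr B p))) <= path_budget c X Y k B.
Proof.
move=> cB pB; have l0 : 0 < 2 / lam by rewrite divr_gt0// lambda_gt0.
have key B' : cells B' \subset cells B ->
    2 / lam * converge_cost (excess X Y k B) + (cut_cost k +
    (cut_budget k.+1 + 2 / lam * converge_budget (excess X Y k.+1 B'))) <=
    path_budget c X Y k B.
  move=> sB; rewrite /path_budget cB.
  have : excess X Y k.+1 B' <= excess X Y k B - del.
    have := AE_subset R X sB; have := AE_subset R Y sB.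
    rewrite /excess -natr1 mulrDl mul1r => hY hX.
    have : Num.max (AE R X B') (AE R Y B') <= Num.max (AE R X B) (AE R Y B).
      by rewrite ge_max !le_max hX hY orbT.
    by lra.
  move=> /converge_budget_step; rewrite -(ler_pM2l l0) mulrDr.
  by have := cut_budget_step k; lra.
have keyl := key _ (cells_cutl_subset pB).
have keyr := key _ (cells_cutr_subset pB).
rewrite {1 2}/path_budget; have [cL|cL] := boolP (c \in cells (cutl B p)).
  by rewrite (negbTE (cells_cut_disjoint pB cL)) addr0.
case: ifP => cR; first by rewrite add0r.
(* If neither half contains [c], both budgets are 0 and the bound for the left half is more than
   enough. *)
apply: le_trans keyl; rewrite add0r !lerD2l addr_ge0 ?cut_budget_ge0//.
rewrite mulr_ge0 ?(ltW l0)//.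
exact: le_trans ler01 (converge_budget_ge1 _).
Qed.

Lemma bisect_single X n k B : #|cells B| = 1%N ->
  bisect eps_r eps_p alpha beta gamma q X n.+1 k B = ret_blocks R [set B]%SET.
Proof. by move=> /eqP B1; cbn [bisect]; rewrite B1. Qed.

Lemma bisect_split X n k B : #|cells B| != 1%N ->
  bisect eps_r eps_p alpha beta gamma q X n.+1 k B =
  dbind (random_converge eps_r eps_p alpha gamma X k B) (fun converged : bool =>
    if converged then ret_blocks R [set B]%SET
    else random_cut eps_r beta gamma q X k B (fun p =>
      dbind (bisect eps_r eps_p alpha beta gamma q X n k.+1 (cutl B p))
        (fun pil : block_set dom =>
      dbind (bisect eps_r eps_p alpha beta gamma q X n k.+1 (cutr B p))
        (fun pir : block_set dom => ret_blocks R (pil :|: pir)%SET)))).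
Proof. by move=> /negbTE B1; cbn [bisect]; rewrite B1. Qed.

Lemma bisect_dominated c X Y n k B : differ_at c X Y ->
  exp_dominated (path_budget c X Y k B)
    (bisect eps_r eps_p alpha beta gamma q X n k B)
    (bisect eps_r eps_p alpha beta gamma q Y n k B).
Proof.
move=> XY; elim: n k B => [|n IH] k B.
  exact: exp_dominated_refl (path_budget_ge0 _ _ _ _ _).
have [B1|B1] := eqVneq #|cells B| 1%N.
  rewrite !bisect_single//.
  exact: exp_dominated_refl (path_budget_ge0 _ _ _ _ _).
rewrite !bisect_split//.
have IHp p : exp_dominated
    (path_budget c X Y k.+1 (cutl B p) + path_budget c X Y k.+1 (cutr B p))
    (dbind (bisect eps_r eps_p alpha beta gamma q X n k.+1 (cutl B p))
      (fun pil : block_set dom =>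
     dbind (bisect eps_r eps_p alpha beta gamma q X n k.+1 (cutr B p))
      (fun pir : block_set dom => ret_blocks R (pil :|: pir))))
    (dbind (bisect eps_r eps_p alpha beta gamma q Y n k.+1 (cutl B p))
      (fun pil : block_set dom =>
     dbind (bisect eps_r eps_p alpha beta gamma q Y n k.+1 (cutr B p))
      (fun pir : block_set dom => ret_blocks R (pil :|: pir)))).
  apply: dbind_exp_dominated => // l.
  rewrite -[path_budget _ _ _ _ _]addr0; apply: dbind_exp_dominated => // r.
  exact: exp_dominated_refl.
have [cB|cB] := boolP (c \in cells B); last first.
  rewrite /path_budget (negbTE cB).
  apply: (@dbind_bool_exp_dominated _ _ _ _ _ _ _ 0 0 0 0 0); rewrite ?addr0//.
  - by rewrite expR0 mul1e (converge_outside _ _ XY cB).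
  - by rewrite expR0 mul1e (converge_outside _ _ XY cB).
  - exact: exp_dominated_refl.
  apply: (random_cut_outside _ XY cB) => p pB.
  apply: (le_exp_dominated _ (IHp p)).
  have outL : c \notin cells (cutl B p).
    by apply: contra cB; exact/fintype.subsetP/cells_cutl_subset.
  have outR : c \notin cells (cutr B p).
    by apply: contra cB; exact/fintype.subsetP/cells_cutr_subset.
  by rewrite /path_budget (negbTE outL) (negbTE outR) addr0.
set ef := 2 / lam * converge_cost (excess X Y k B).
(* Converging costs [2 / lam], which the budget always contains; not converging costs [ef], and what
   is left goes to the cut and to the two halves. *)
apply: (@dbind_bool_exp_dominated _ _ _ _ _ _ _ _ (2 / lam) ef 0
  (cut_cost k + (path_budget c X Y k B - ef - cut_cost k))).
- exact: converge_dominated XY cB.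
- exact: not_converge_dominated XY cB.
- exact: exp_dominated_refl.
- apply: (random_cut_dominated _ XY cB B1) => p pB.
  apply: (le_exp_dominated _ (IHp p)).
  by rewrite -addrA -opprD lerBrDr addrC -addrA; exact: path_budget_cut.
- rewrite addr0 /path_budget cB -[leLHS]add0r lerD ?cut_budget_ge0//.
  rewrite ler_peMr ?converge_budget_ge1// divr_ge0// ltW//.
  exact: lambda_gt0.
- by lra.
Qed.

Lemma recursive_bisection_private : diff_private eps_r
  (recursive_bisection eps_r eps_p alpha beta gamma q).
Proof.
move=> X Y /neighbor_differ_at[c XY] Z mZ.
apply: (le_exp_dominated _ (bisect_dominated _ _ _ XY)) => //.
rewrite /path_budget; case: ifP => _; last exact: ltW.
rewrite [leRHS](_ : _ = (1 - gamma) * eps_r + gamma * eps_r); last by ring.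
apply: lerD; first exact: cut_budget1.
rewrite -max_converge_budgetE ler_pM2l; last by rewrite divr_gt0// lambda_gt0.
exact: converge_budget_le.
Qed.

End bisection.

(** * Privacy of the perturbation and of the whole algorithm *)

Section perturbation.
Context (R : realType) (d : nat) (disp : Order.disp_t).
Context (dom : 'I_d -> finTBOrderType disp).
Implicit Types (B : block dom) (P : {set block dom}) (X Y : database dom).

(** Weaker than [is_partition]: it retains what bounds the sensitivity of the sums, and it is easily
    propagated through the recursion. *)
Definition disjoint_blocks P : Prop := forall B B' (c : cell dom),
  B \in P -> B' \in P -> c \in cells B -> c \in cells B' -> B = B'.

Lemma partition_disjoint_blocks P : is_partition P -> disjoint_blocks P.
Proof.
move=> PP B B' c BP B'P cB cB'; have [B0 [_ B0E]] := PP c.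
by rewrite -(B0E B)// -(B0E B').
Qed.

Lemma block_sum_dist c X Y B : differ_at c X Y ->
  `|(block_sum X B)%:R - (block_sum Y B)%:R| <= (c \in cells B)%:R :> R.
Proof.
move=> XY; rewrite /block_sum !natr_sum -sumrB.
have XY0 c' : c' != c -> (X c')%:R - (Y c')%:R = 0 :> R.
  by move=> /XY.1 ->; rewrite subrr.
have [cB|cB] := boolP (c \in cells B); last first.
  rewrite big1 ?normr0// => c' c'B; apply: XY0.
  by apply: contraNneq cB => <-.
rewrite (bigD1 c)//= big1 ?addr0; first exact: differ_at_dist XY.
by move=> c' /andP[_ /XY0].
Qed.

(** At most one block of [P] contains [c], and the sums of the others agree. *)
Lemma sum_block_sum_dist c X Y P : differ_at c X Y -> disjoint_blocks P ->
  \sum_(B in P) `|(block_sum X B)%:R - (block_sum Y B)%:R| <= 1 :> R.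
Proof.
move=> XY dP; have [B BP|P0] := pickP [pred B in P | c \in cells B]; last first.
  rewrite big1// => B BP; apply/eqP; rewrite -normr_le0 normr_id.
  apply: (le_trans (block_sum_dist B XY)).
  by have := P0 B; rewrite /= BP/= => ->.
have /andP[BP' cB] := BP.
rewrite (bigD1 B)//= big1 ?addr0.
  by apply: (le_trans (block_sum_dist B XY)); rewrite cB.
move=> B' /andP[B'P B'B]; apply/eqP; rewrite -normr_le0 normr_id.
apply: (le_trans (block_sum_dist B' XY)).
case: (boolP (c \in cells B')) => // cB'.
by rewrite (dP _ _ _ B'P BP' cB' cB) eqxx in B'B.
Qed.

Lemma perturbation_private (eps_p : R) c X Y P : 0 < eps_p ->
  differ_at c X Y -> disjoint_blocks P ->
  exp_dominated eps_p (perturbation eps_p X P) (perturbation eps_p Y P).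
Proof.
move=> e0 XY dP Z mZ.
have := @laplace_tuple_shift R eps_p^-1 _ (fun i => (block_sum X (enum_val i))%:R)
  (fun i : 'I_#|P| => (block_sum Y (enum_val i))%:R) _ _ (mZ P).
rewrite invr_gt0 => /(_ e0) h; apply: (le_trans h).
rewrite lee_wpmul2r// lee_fin ler_expR invrK.
rewrite -mulr_suml ler_piMl ?(ltW e0)//.
rewrite -(big_enum_val (fun B => `|(block_sum X B)%:R - (block_sum Y B)%:R|)).
exact: sum_block_sum_dist XY dP.
Qed.

End perturbation.

(** * Almost sure disjointness of the blocks, and composition with the noise *)

Section support.
Context (R : realType) (d : nat) (disp : Order.disp_t).
Context (dom : 'I_d -> finTBOrderType disp).
Context (eps_r eps_p alpha beta gamma : R).
Context (q : nat -> block dom -> cutpoint dom -> {nonneg R}).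
Implicit Types (B : block dom) (P : {set block dom}) (X Y : database dom).

(** The inclusion in [B] makes the invariant inductive: families produced by two disjoint halves
    cannot overlap. *)
Definition packing B : set (block_set dom) := [set P : block_set dom |
  disjoint_blocks P /\
  forall B', B' \in (P : {set block dom}) -> cells B' \subset cells B].

Lemma packing1 B : packing B [set B]%SET.
Proof.
split=> [B1 B2 c|B']; rewrite !inE; last by move=> /eqP ->.
by move=> /eqP -> /eqP ->.
Qed.

Lemma packingU B p (P P' : block_set dom) : p \in cuts B ->
  packing (cutl B p) P -> packing (cutr B p) P' -> packing B (P :|: P')%SET.
Proof.
move=> pB [dP sP] [dP' sP']; split=> [B1 B2 c|B']; rewrite !finset.in_setU.
  have lr Bl Br : Bl \in (P : {set block dom}) -> Br \in (P' : {set block dom}) ->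
      c \in cells Bl -> c \in cells Br -> False.
    move=> /sP/fintype.subsetP sl /sP'/fintype.subsetP sr /sl cl /sr cr.
    by have := cells_cut_disjoint pB cl; rewrite cr.
  move=> /orP[B1P|B1P] /orP[B2P|B2P] c1 c2.
  - exact: (dP _ _ _ B1P B2P c1 c2).
  - by case: (lr _ _ B1P B2P c1 c2).
  - by case: (lr _ _ B2P B1P c2 c1).
  - exact: (dP' _ _ _ B1P B2P c1 c2).
case/orP => [/sP|/sP'] h; apply: (fintype.subset_trans h).
  exact: cells_cutl_subset.
exact: cells_cutr_subset.
Qed.

Lemma ret_blocks_eq0 P (N : set (block_set dom)) : ~ N P -> ret_blocks R P N = 0%E.
Proof. by move=> NP; rewrite /ret_blocks /giry_ret/= diracE memNset. Qed.

Lemma bisect_packing X n k B :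
  bisect eps_r eps_p alpha beta gamma q X n k B (~` packing B) = 0%E.
Proof.
have stop B' : ret_blocks R [set B']%SET (~` packing B') = 0%E.
  by apply: ret_blocks_eq0 => /(_ (packing1 B')).
elim: n k B => [|n IH] k B; first exact: stop.
have [B1|B1] := eqVneq #|cells B| 1%N; first by rewrite bisect_single.
rewrite bisect_split//.
apply: (@dbind_eq0 _ _ _ _ _ _ _ set0) => // -[_|_]; first exact: stop.
have IHp p : p \in cuts B ->
  dbind (bisect eps_r eps_p alpha beta gamma q X n k.+1 (cutl B p))
    (fun pil : block_set dom =>
  dbind (bisect eps_r eps_p alpha beta gamma q X n k.+1 (cutr B p))
    (fun pir : block_set dom => ret_blocks R (pil :|: pir)%SET)) (~` packing B) = 0%E.
  move=> pB; apply: (dbind_eq0 _ (IH k.+1 (cutl B p))) => // l /contrapT pl.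
  apply: (dbind_eq0 _ (IH k.+1 (cutr B p))) => // r /contrapT pr.
  by apply: ret_blocks_eq0 => /(_ (packingU pB pl pr)).
rewrite /random_cut; case: ifP => _ /=; rewrite /draw big1// => p pB.
  by rewrite IHp// mule0.
by rewrite IHp// mule0.
Qed.

(** The noise is private for disjoint families only; the other outputs of the bisection of [Y] form
    a null set, as the composition demands. *)
Lemma hdpview_private : 0 < eps_p ->
  diff_private eps_r (recursive_bisection eps_r eps_p alpha beta gamma q) ->
  diff_private (eps_r + eps_p) (hdpview eps_r eps_p alpha beta gamma q).
Proof.
move=> e0 rb X Y XY; have [c cXY] := neighbor_differ_at XY.
apply: (dbind_exp_dominated_ae (rb X Y XY) (bisect_packing Y _ _ _)).
by move=> P /contrapT[dP _]; exact: perturbation_private cXY dP.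
Qed.

End support.

Theorem mainTheorem1 (R : realType) (d : nat) (disp : Order.disp_t)
    (dom : 'I_d -> finTBOrderType disp)
    (eps_b eps_r eps_p alpha beta gamma : R)
    (q : nat -> block dom -> cutpoint dom -> {nonneg R})
    (eps_b_gt0 : 0 < eps_b) (eps_bE : eps_b = eps_r + eps_p)
    (eps_r_gt0 : 0 < eps_r) (eps_p_gt0 : 0 < eps_p)
    (alpha_gt1 : 1 < alpha) (beta_gt0 : 0 < beta)
    (gamma_gt0 : 0 < gamma) (gamma_le1 : gamma <= 1)
    (q_distr : forall (k : nat) (B : block dom),
      cuts B != finset.set0 -> \sum_(p in cuts B) (q k B p)%:num = 1) :
  [/\ diff_private eps_r
        (recursive_bisection eps_r eps_p alpha beta gamma q),
      forall P : block_set dom, is_partition P ->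
        diff_private eps_p (fun X : database dom => perturbation eps_p X P)
    & diff_private eps_b (hdpview eps_r eps_p alpha beta gamma q)].
Proof.
have rb : diff_private eps_r (recursive_bisection eps_r eps_p alpha beta gamma q).
  exact: recursive_bisection_private.
split=> // [P PP X Y /neighbor_differ_at[c XY]|].
  exact: perturbation_private XY (partition_disjoint_blocks PP).
by rewrite eps_bE; exact: hdpview_private.
Qed.
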